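(* Let $n$ be a positive integer. There exist positive integers $x,y,z$ with $n=x+y+z$ such that $x^2+y^2+z^2$ is a perfect square if and only if $n$ is neither of the form $2^a3^b$ with $a,b$ nonnegative integers nor of the form $2^a\cdot 7$ with $a$ a nonnegative integer.
   Context: A perfect square means the square of an integer. *)

(* Defs.v *)
From mathcomp Require Import all_boot all_algebra.
Set Implicit Arguments.
Unset Strict Implicit.
Unset Printing Implicit Defensive.

Definition perfect_square (k : nat) : Prop :=
  exists m : int, (k%:Z = m ^+ 2)%R.

(* Main.v *)
Require Import Defs.
From mathcomp Require Import all_boot all_algebra.
From mathcomp Require Import all_order finfield zify ring lra.
Import Order.TTheory GRing.Theory Num.Theory.

(** Call n split when n = x + y + z with x, y, z positive and
    x^2 + y^2 + z^2 a square.

    Necessity is a descent.  Modulo 4, a splitting of an even number has all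
    parts even; modulo 9, a splitting of a multiple of 9 has all parts
    divisible by 3.  So 2^a * 3^b and 2^a * 7 reduce to 1, 3 and 7, which are
    checked by hand.

    For sufficiency, multiples of split numbers are split, so it is enough to
    split 21, 49 and every prime p > 3 other than 7.  For Gaussian integers
    a + bi and d + ci of norms S and T, with product P + Qi, the equality
    P^2 + Q^2 = S * T gives
      (2(P+Q) - S - T)^2 + (2(S-P))^2 + (2(S-Q))^2 = (3S - 2(P+Q) + T)^2,
    and the three parts on the left add up to 3S - T.  They are positive when
    the product points near the diagonal and T/S is moderate
    ([square_split_window]).

    If p = 1 mod 4, then p is a sum of two squares, which splits p directly.
    If p = 3 mod 4, then 3 or -3 is a square modulo p, and Thue's pigeonhole
    argument represents p, or 2p, by 3y^2 - x^2 or by 3y^2 + x^2.  Such a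
    representation has the form 3S - T, but may lie outside the region of
    positivity when x is small compared to y.  Since 3b^2 - d^2 is invariant
    under multiplication of d + b*sqrt 3 by the unit 2 + sqrt 3, the pair
    (b, d) can be enlarged without changing 3S - T.  When x is small compared
    to y, the admissible values of b/a form an interval whose endpoints have a
    ratio slightly above 2 + sqrt 3, while each step multiplies b by about
    2 + sqrt 3, so the walk cannot jump over it ([window_step]).  The only
    failure is at the start of the walk for 3y^2 + x^2: its first two points
    both lie on the boundary when y = 3x, where 3y^2 + x^2 = 28x^2, and this
    is how the prime 7 is lost. *)

(** * Descent: the numbers that are not split *)

Definition square_split (n : nat) : Prop :=
  exists x y z : nat,
    [/\ 0 < x, 0 < y, 0 < z, n = x + y + z
      & perfect_square (x ^ 2 + y ^ 2 + z ^ 2)].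

Lemma square_splitE n : square_split n <->
  exists x y z m : nat, [/\ 0 < x, 0 < y, 0 < z, n = x + y + z
      & x ^ 2 + y ^ 2 + z ^ 2 = m ^ 2].
Proof.
split=> [[x [y [z [x0 y0 z0 -> [m E]]]]]|[x [y [z [m [x0 y0 z0 -> E]]]]]].
  by exists x, y, z, `|m|%N; split=> //; lia.
by exists x, y, z; split=> //; exists (m%:Z)%R; rewrite E; lia.
Qed.

Lemma square_split_muln k n : 0 < k -> square_split n -> square_split (k * n).
Proof.
move=> k0 /square_splitE[x [y [z [m [x0 y0 z0 -> E]]]]].
apply/square_splitE; exists (k * x), (k * y), (k * z), (k * m).
by split; rewrite ?muln_gt0 ?k0 // ?mulnDr // !expnMn -!mulnDr E.
Qed.

Lemma sqr_mod4 x : x ^ 2 = odd x %[mod 4].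
Proof.
rewrite -{1}(odd_double_half x) sqrnD -mul2n.
case: (odd x); nia.
Qed.

(** As x + y + z is even and squares are 0 or 1 modulo 4, a sum of three
    squares with two odd terms is 2 modulo 4 and is not a square. *)
Lemma square_split_half n : square_split (2 * n) -> square_split n.
Proof.
move=> /square_splitE[x [y [z [m [x0 y0 z0 s E]]]]]; apply/square_splitE.
have := (sqr_mod4 x, sqr_mod4 y, sqr_mod4 z, sqr_mod4 m).
move=> [[[hx hy] hz] hm].
have [ex ey ez em]: [/\ x = 2 * x./2, y = 2 * y./2, z = 2 * z./2 & m = 2 * m./2].
  by move: (odd x) (odd y) (odd z) (odd m) (odd_double_half x) (odd_double_half y)
    (odd_double_half z) (odd_double_half m) hx hy hz hm => [] [] [] [] /=; rewrite -!mul2n;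
    move: (x ^ 2) (y ^ 2) (z ^ 2) (m ^ 2) E => *; split; lia.
move: x./2 y./2 z./2 m./2 ex ey ez em {hx hy hz hm} => x' y' z' m' ex ey ez em.
rewrite {}ex {}ey {}ez {}em !expnMn -!mulnDr in x0 y0 z0 s E.
exists x', y', z', m'; split; lia.
Qed.

(** Modulo 3, the parts are either all 0 or all equal to some u <> 0.  In the
    second case write them as u + 3a, u + 3b, u + 3c.  As 9 divides their sum,
    a + b + c = - u modulo 3, and the sum of their squares is
    3u^2 + 6u(a+b+c) = - 3u^2 modulo 9: divisible by 3 but not by 9. *)
Lemma square_split_third n : square_split (3 * (3 * n)) -> square_split (3 * n).
Proof.
move=> /square_splitE[x [y [z [m [x0 y0 z0 s E]]]]]; apply/square_splitE.
have D t : exists q, exists2 r, r < 3 & t = 3 * q + r.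
  by exists (t %/ 3), (t %% 3); lia.
have [[a [u hu ex]] [b [v hv ey]] [c [w hw ez]] [d [t ht em]]] := And4 (D x) (D y) (D z) (D m).
rewrite {}ex {}ey {}ez {}em in x0 y0 z0 s E.
have sq q r : (3 * q + r) ^ 2 = 9 * q ^ 2 + 6 * (q * r) + r ^ 2 by ring.
rewrite !sq in E.
have s3 : (u + v + w) %% 3 == 0 by lia.
have E3 : (u ^ 2 + v ^ 2 + w ^ 2) %% 3 == (t ^ 2) %% 3.
  move: (a ^ 2) (b ^ 2) (c ^ 2) (d ^ 2) (a * u) (b * v) (c * w) (d * t) E {x0 y0 z0 s}.
  by move: (u ^ 2) (v ^ 2) (w ^ 2) (t ^ 2) => *; lia.
have [[u0 v0 w0 t0]|[uv uw t0 u0]] :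
    [/\ u = 0, v = 0, w = 0 & t = 0] \/ [/\ v = u, w = u, t = 0 & 0 < u].
- by move: u v w t hu hv hw ht s3 E3 {x0 y0 z0 s E}
    => [|[|[|?]]] // [|[|[|?]]] // [|[|[|?]]] // [|[|[|?]]] // *; [left|right|right].
- by exists a, b, c, d; move: E; rewrite u0 v0 w0 t0 => E; split; lia.
- move: s E; rewrite uv uw t0.
  have [->|->] : u = 1 \/ u = 2 by lia.
    by move: (a ^ 2) (b ^ 2) (c ^ 2) (d ^ 2) => *; lia.
  by move: (a ^ 2) (b ^ 2) (c ^ 2) (d ^ 2) => *; lia.
Qed.

(** Bounds the search for a splitting, so that small cases are decided by
    computation. *)
Lemma square_split_search n : square_split n ->
  has (fun x => has (fun y => has (fun m =>
      (x + y < n) && (x ^ 2 + y ^ 2 + (n - x - y) ^ 2 == m ^ 2))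
    (iota 0 n)) (iota 1 n)) (iota 1 n).
Proof.
move=> /square_splitE[x [y [z [m [x0 y0 z0 s E]]]]].
apply/hasP; exists x; first by rewrite mem_iota; lia.
apply/hasP; exists y; first by rewrite mem_iota; lia.
apply/hasP; exists m; first by rewrite mem_iota; nia.
by have -> : n - x - y = z; [lia|rewrite E eqxx; lia].
Qed.

Lemma square_split1 : ~ square_split 1. Proof. by move=> /square_split_search. Qed.
Lemma square_split3 : ~ square_split 3. Proof. by move=> /square_split_search. Qed.
Lemma square_split7 : ~ square_split 7. Proof. by move=> /square_split_search. Qed.

Lemma square_split_int (n : nat) (x y z m : int) :
  (0 < x -> 0 < y -> 0 < z -> x + y + z = n%:Z ->
  x ^+ 2 + y ^+ 2 + z ^+ 2 = m ^+ 2 -> square_split n)%R.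
Proof.
move=> x0 y0 z0 s E; apply/square_splitE.
by exists `|x|%N, `|y|%N, `|z|%N, `|m|%N; split; lia.
Qed.

(** * A parametrized family of splittings, and the walk towards positivity *)

Local Open Scope ring_scope.

(** The first two hypotheses are P < S and Q < S, the third one is
    S + T < 2(P + Q), where P + Qi = (a + bi)(d + ci). *)
Lemma square_split_window (n : nat) (a b c d : int) :
  a * d - b * c < a ^+ 2 + b ^+ 2 ->
  b * d + a * c < a ^+ 2 + b ^+ 2 ->
  a ^+ 2 + b ^+ 2 + c ^+ 2 + d ^+ 2 < 2 * (a * d - b * c + (b * d + a * c)) ->
  3 * (a ^+ 2 + b ^+ 2) - c ^+ 2 - d ^+ 2 = n%:Z -> square_split n.
Proof.
move=> ltP ltQ ltST En.
pose S := a ^+ 2 + b ^+ 2; pose T := c ^+ 2 + d ^+ 2.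
pose P := a * d - b * c; pose Q := b * d + a * c.
apply: (@square_split_int n (2 * (P + Q) - S - T) (2 * (S - P)) (2 * (S - Q))
  (3 * S - 2 * (P + Q) + T)).
- by rewrite /S /T /P /Q; lra.
- by rewrite /S /P; lra.
- by rewrite /S /Q; lra.
- by rewrite -En /S /T /P /Q; ring.
- by rewrite /S /T /P /Q; ring.
Qed.

(** The last hypothesis says that the third condition of [square_split_window]
    fails, that is, (a - d - c)^2 >= 2cd + 2bd - b^2 - 2bc.  So a is either too
    small or too large compared to b.  The bound Q < S excludes the first
    alternative, and in the second one there is enough room for the bound
    Q < S to survive the multiplication of d + b*sqrt 3 by 2 + sqrt 3. *)
Lemma window_step (a b c d : int) :
  0 < b -> 0 <= c -> 3 * c <= b -> 5 * b <= 3 * d -> d <= 2 * b -> 0 < a ->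
  b * d + a * c < a ^+ 2 + b ^+ 2 ->
  2 * (a * d - b * c + (b * d + a * c)) <= a ^+ 2 + b ^+ 2 + c ^+ 2 + d ^+ 2 ->
  (2 * b + d) * (3 * b + 2 * d) + a * c < a ^+ 2 + (2 * b + d) ^+ 2.
Proof.
move=> b0 c0 cb bd db a0 ltQ leST.
have ab : 3 * b < 4 * a by nra.
pose e := a - d - c.
have e2 : 2 * b * d - b ^+ 2 <= e ^+ 2 by rewrite /e; nra.
have e0 : 0 <= e.
  rewrite leNgt; apply/negP => e0.
  (* Here 4a > 3b bounds |e| by d - 5b/12, which is too small for e2 when
     5b/3 <= d <= 2b. *)
  have f : 0 < - (12 * e) /\ - (12 * e) < 12 * d - 5 * b by rewrite /e in e0 *; lia.
  have : 144 * e ^+ 2 < (12 * d - 5 * b) ^+ 2 by nra.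
  have : 0 <= (3 * d - 5 * b) * (2 * b - d) by nra.
  nra.
have e3 : 3 * b <= 2 * e by nra.
have -> : a = e + d + c by rewrite /e; ring.
nra.
Qed.

(** The linear conditions on b, c, d say that d/b is close to sqrt 3 and c is
    small; they are stable under (b, d) |-> (2b + d, 3b + 2d), while b grows
    and Q < S keeps it below 2a.  Hence the walk stops, in the region of
    [square_split_window]. *)
Lemma square_split_walk (n : nat) (a b c d : int) :
  0 < a -> 0 < b -> 0 <= c -> 3 * c <= b -> 5 * b <= 3 * d -> d <= 2 * b ->
  b * d + a * c < a ^+ 2 + b ^+ 2 ->
  3 * (a ^+ 2 + b ^+ 2) - c ^+ 2 - d ^+ 2 = n%:Z -> square_split n.
Proof.
move=> a0 b0 c0 cb bd db ltQ En.
have [k lek] : exists k : nat, 2 * a - b < k%:Z by exists `|a|%N.*2; lia.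
elim: k => [|k IHk] in b d b0 cb bd db ltQ En lek *.
  have : b <= 2 * a by nra.
  lia.
have [ltST|leST] := ltrP (a ^+ 2 + b ^+ 2 + c ^+ 2 + d ^+ 2)
                         (2 * (a * d - b * c + (b * d + a * c))).
  apply: (square_split_window n a b c d) => //.
  (* P < S holds because S - P = (a - b)^2 + a(2b - d) + bc, and
     a = b is incompatible with d = 2b and Q < S. *)
  have sq0 : 0 <= (a - b) ^+ 2 by apply: sqr_ge0.
  have bc0 : 0 <= b * c by nra.
  have [dlt|dge] := ltrP d (2 * b); first by nra.
  have ed : d = 2 * b by lia.
  have ltba : b < a by rewrite ed in ltQ; nra.
  by rewrite ed; nra.
apply: (IHk (2 * b + d) (3 * b + 2 * d)); try lia.
exact: window_step.
Qed.

(** The walk starts at (b, d) = (x, 2x), the image of (0, x). *)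
Lemma square_split_3sqB (n : nat) (a x : int) :
  0 < x -> x < a -> 3 * a ^+ 2 - x ^+ 2 = n%:Z -> square_split n.
Proof.
move=> x0 xa En.
by apply: (@square_split_walk n a x 0 (2 * x)); nia.
Qed.

(** If a < 3x, the point b = c = d = x is already in the region.  The first
    point of its orbit with d/b close enough to sqrt 3 is (3x, 5x), and there
    Q < S amounts to (a - 3x)(a + 2x) > 0. *)
Lemma square_split_3sqD (n : nat) (a x : int) :
  0 < x -> x < a -> a != 3 * x -> 3 * a ^+ 2 + x ^+ 2 = n%:Z -> square_split n.
Proof.
move=> x0 xa ax3 En.
have [ax|ax] := ltrP a (3 * x).
  by apply: (@square_split_window n a x x x); nia.
by apply: (@square_split_walk n a (3 * x) x (5 * x)); try lia; nia.
Qed.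

Lemma square_split_sum2sq (n : nat) (a b : int) :
  0 < b -> b < a -> a ^+ 2 + b ^+ 2 = n%:Z -> square_split n.
Proof.
move=> b0 ba En.
apply: (@square_split_int n ((a - b) ^+ 2) (2 * b * (a - b)) (2 * b ^+ 2)
          (a ^+ 2 - 2 * a * b + 3 * b ^+ 2)); rewrite -?En; try nia; try ring.
Qed.

(** * Square roots modulo a prime and small representations *)

(** Thue's lemma: among the more than p pairs (i, j) with entries at most the
    integer part r of sqrt p, two have the same i - s * j modulo p. *)
Lemma thue_prime (p : nat) (d : int) (s : 'F_p) :
  prime p -> s ^+ 2 = d%:~R -> exists x y : int,
  [/\ 0 <= x /\ 0 <= y, 0 < x + y, x ^+ 2 < p%:Z, y ^+ 2 < p%:Z &
    exists k : int, x ^+ 2 - d * y ^+ 2 = k * p%:Z].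
Proof.
move=> pp s2.
have [r rp pr] : exists2 r : nat, (r ^ 2 < p)%N & (p < r.+1 ^ 2)%N.
  have ex0 : exists r, (r ^ 2 < p)%N by exists 0%N; rewrite prime_gt0.
  have ub r : (r ^ 2 < p)%N -> (r <= p)%N by nia.
  have [r rp rmax] := ex_maxnP ex0 ub; exists r => //.
  rewrite ltn_neqAle leqNgt; apply/andP; split; last first.
    by apply/negP => /rmax; rewrite ltnn.
  apply/negP => /eqP E; move: pp; rewrite E; case: (r) rp E => [|q] _ _ //.
  by apply/negP/primePn; right; exists q.+2; [nia|rewrite -mulnn dvdn_mulr].
pose f (u : 'I_r.+1 * 'I_r.+1) : 'F_p := (u.1 : nat)%:R - s * (u.2 : nat)%:R.
have /injectivePn[[i j] [[i' j'] neq /= Ef]] : ~~ injectiveb f.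
  apply/injectiveP => /leq_card; rewrite card_prod card_ord card_Fp //.
  by rewrite leqNgt mulnn pr.
pose x : int := i%:Z - i'%:Z; pose y : int := j%:Z - j'%:Z.
have Exy : x%:~R = s * y%:~R :> 'F_p.
  have /eqP := Ef; rewrite -subr_eq0 /f /= => /eqP E0.
  by apply/subr0_eq; rewrite -E0 !intrB -!pmulrn; ring.
exists `|x|, `|y|; split.
- by rewrite !normr_ge0.
- rewrite lt_neqAle eq_sym paddr_eq0 ?normr_ge0 // !normr_eq0 addr_ge0 ?andbT //.
  apply: contra neq; rewrite /x /y !subr_eq0 !eqz_nat => /andP[/eqP xi /eqP yj].
  by rewrite -pair_eqE /= -!val_eqE /= xi yj !eqxx.
- rewrite real_normK ?num_real // /x.
  have := ltn_ord i; have := ltn_ord i'; nia.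
- rewrite real_normK ?num_real // /y.
  have := ltn_ord j; have := ltn_ord j'; nia.
rewrite !real_normK ?num_real //; apply/dvdzP.
rewrite (dvdz_pcharf (pchar_Fp pp)) intrB intrM !rmorphXn /= Exy -s2.
by rewrite exprMn subrr.
Qed.

Lemma Fp_half_power (p : nat) (a : 'F_p) (h : nat) :
  prime p -> p = h.*2.+1 -> a != 0 -> a ^+ h = 1 \/ a ^+ h = - 1.
Proof.
move=> pp ph a0; suff : a ^+ h ^+ 2 == 1 ^+ 2.
  by rewrite eqf_sqr => /orP[] /eqP; [left|right].
rewrite expr1n -exprM muln2.
have pE : #|'F_p| = h.*2.+1 by rewrite card_Fp.
have /eqP := expf_card a; rewrite pE exprS.
by rewrite -subr_eq0 -[X in _ - X]mulr1 -mulrBr mulf_eq0 (negPf a0) subr_eq0.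
Qed.

(** For p = 4k + 3, the square of a^(k+1) is a * a^(2k+1), and a^(2k+1) is
    1 or -1. *)
Lemma Fp_sqrt_pm (p : nat) (a : 'F_p) :
  prime p -> (p %% 4 = 3)%N -> a != 0 -> exists s : 'F_p, s ^+ 2 = a \/ s ^+ 2 = - a.
Proof.
move=> pp p4 a0; exists (a ^+ (p %/ 4)%N.+1).
have ph : p = (p %/ 4)%N.*2.+1.*2.+1 by lia.
have := Fp_half_power p a _ pp ph a0.
have -> : (a ^+ (p %/ 4)%N.+1) ^+ 2 = a * a ^+ (p %/ 4)%N.*2.+1.
  by rewrite -exprM -exprS; congr (_ ^+ _); lia.
by case=> ->; [left; rewrite mulr1|right; rewrite mulrN1].
Qed.

(** For p = 4k + 1, the polynomial X^(2k) - 1 has at most 2k < p - 1 roots, so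
    a^(2k) = -1 for some a, and a^k is a square root of -1. *)
Lemma Fp_sqrtN1 (p : nat) :
  prime p -> (p %% 4 = 1)%N -> exists s : 'F_p, s ^+ 2 = - 1.
Proof.
move=> pp p4; have p1 := prime_gt1 pp.
pose h := (p %/ 4)%N.*2; have ph : p = h.*2.+1 by rewrite /h; lia.
have h0 : (0 < h)%N by rewrite /h; lia.
have [a a0 ah] : exists2 a : 'F_p, a != 0 & a ^+ h != 1.
  have [/forallP all1|] := boolP [forall a : 'F_p, (a != 0) ==> (a ^+ h == 1)].
    have := @max_unity_roots _ h (enum [pred a : 'F_p | a != 0]) h0.
    rewrite enum_uniq -cardE cardC1 card_Fp // => H.
    have : (p.-1 <= h)%N.
      apply: H => //; apply/allP => a; rewrite mem_enum inE => a0.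
      by apply/unity_rootP/eqP; have := all1 a; rewrite a0.
    lia.
  by rewrite negb_forall => /existsP[a]; rewrite negb_imply => /andP[]; exists a.
have [/eqP E|E] := Fp_half_power p a h pp ph a0; first by rewrite E in ah.
by exists (a ^+ (p %/ 4)%N); rewrite -exprM muln2.
Qed.

(** Rules out the degenerate representations of a prime by a binary form, such
    as those on the line x = y. *)
Lemma prime_mul_sqr (p : nat) (k y : int) :
  prime p -> p%:Z = k * y ^+ 2 -> p%:Z = k.
Proof.
move=> pp E.
have Ep : p = (`|k| * `|y| ^ 2)%N by rewrite -abszX -abszM -E.
have : (`|y| %| p)%N by rewrite Ep -mulnn mulnA dvdn_mull.
case/primeP: pp => p1 dv /dv /orP[/eqP y1|/eqP yp].
  by rewrite E -[y ^+ 2]real_normK ?num_real // -abszE y1 expr1n mulr1.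
by move: Ep; rewrite yp; case: `|k|%N => [|q]; nia.
Qed.

(** * Splitting primes *)

Lemma square_split_prime_sqDsq (p : nat) (x y : int) :
  prime p -> (2 < p)%N -> 0 <= x -> 0 <= y -> x ^+ 2 + y ^+ 2 = p%:Z ->
  square_split p.
Proof.
move=> pp p2; wlog xy : x y / y <= x.
  move=> W x0 y0 E; have [yx|/ltW yx] := lerP y x; first exact: (W x y).
  by apply: (W y x); rewrite // addrC.
move=> x0 y0 E.
have y1 : 0 < y.
  rewrite lt_neqAle y0 andbT; apply/eqP => ye.
  by have := prime_mul_sqr p 1 x pp; rewrite -E -ye; lia.
have yltx : y < x.
  rewrite lt_neqAle xy andbT; apply/eqP => ye.
  by have := prime_mul_sqr p 2 x pp; rewrite -E ye; lia.
exact: square_split_sum2sq E.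
Qed.

(** When x > y, the unit 2 - sqrt 3 reflects the representation into one with
    x < y. *)
Lemma square_split_prime_3sqBsq (p : nat) (x y : int) :
  prime p -> (3 < p)%N -> 0 <= x -> 0 <= y -> 2 * x ^+ 2 < 3 * y ^+ 2 ->
  3 * y ^+ 2 - x ^+ 2 = p%:Z -> square_split p.
Proof.
move=> pp p3 x0 y0 lexy E.
have xn0 : x <> 0.
  by move=> x_0; have := prime_mul_sqr p 3 y pp; rewrite -E x_0; lia.
have [xlty|yltx|xy] := ltrgtP x y.
- by apply: (square_split_3sqB p y x); lia.
- have x54 : 4 * x < 5 * y by nra.
  (* If 2x = 3y, then p = 3(x - y)^2. *)
  have n0 : 2 * x <> 3 * y.
    move=> xy; have := prime_mul_sqr p 3 (x - y) pp.
    have -> : 3 * (x - y) ^+ 2 = 3 * y ^+ 2 - x ^+ 2.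
      have [t ->] : exists t, y = 2 * t by exists (x - y); lia.
      have -> : x = 3 * t by lia.
      by ring.
    by rewrite E; lia.
  apply: (square_split_3sqB p (2 * y - x) `|2 * x - 3 * y|); lia.
- by have := prime_mul_sqr p 2 y pp; rewrite -E xy; lia.
Qed.

Lemma int_even_or_odd (x : int) : exists t, x = 2 * t \/ x = 2 * t + 1.
Proof. by exists (x %/ 2)%Z; lia. Qed.

(** The 3-adic valuations have different parities. *)
Lemma sqr_neq_3sqr (x y : int) : 0 < y -> x ^+ 2 <> 3 * y ^+ 2.
Proof.
move=> y0 E.
have E' : (`|x| ^ 2 = 3 * `|y| ^ 2)%N by rewrite -!abszX E abszM.
have x0 : (0 < `|x|)%N.
  by rewrite absz_gt0; apply/eqP => xe; rewrite xe in E; nia.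
have := congr1 (logn 3) E'; rewrite lognM ?expn_gt0 ?absz_gt0 ?gt_eqF //.
by rewrite !lognX (@logn_prime 3 3) //=; lia.
Qed.

(** Thue's lemma makes x^2 - 3y^2 one of -p, -2p and 0.  For -2p it is 2p that
    is split, since x < y is then automatic. *)
Lemma square_split_prime_sqrt3 (p : nat) (s : 'F_p) :
  prime p -> (3 < p)%N -> s ^+ 2 = 3 -> square_split p.
Proof.
move=> pp p3 s2.
have [x [y [[x0 y0] xy xp yp [k E]]]] := thue_prime p 3 s pp s2.
have y1 : 0 < y.
  rewrite lt_neqAle y0 andbT; apply/eqP => ye; rewrite -ye in E.
  have [kp k1] : 0 < k /\ k < 1 by split; nia.
  lia.
have [k1|[k2|k0]] : k = -1 \/ k = -2 \/ k = 0 by nia.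
- by apply: (square_split_prime_3sqBsq p x y) => //; rewrite k1 in E; nia.
- apply: square_split_half.
  apply: (square_split_3sqB _ y x); try (rewrite k2 in E; nia).
  rewrite lt_neqAle x0 andbT; apply/eqP => xe; rewrite -xe k2 in E.
  have [t [yt|yt]] := int_even_or_odd y; last by rewrite yt in E; lia.
  have p6 : p = 6%N by have := prime_mul_sqr p 6 t pp; rewrite yt in E; lia.
  by rewrite p6 in pp.
- by case: (sqr_neq_3sqr x y y1); rewrite k0 in E; lia.
Qed.

(** When x > y, rotating x + y*sqrt(-3) by a sixth of a turn gives
    4p = (x - 3y)^2 + 3(x + y)^2 with |x - 3y| < x + y; it remains to halve a
    splitting of 4p twice. *)
Lemma square_split_prime_sqD3sq (p : nat) (x y : int) :
  prime p -> (3 < p)%N -> p != 7%N -> 0 <= x -> 0 <= y ->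
  x ^+ 2 + 3 * y ^+ 2 = p%:Z -> square_split p.
Proof.
move=> pp p3 p7 x0 y0 E.
have sqF := prime_mul_sqr p _ _ pp.
have xn0 : x <> 0 by move=> xe; have := sqF 3 y; rewrite -E xe; lia.
have yn0 : y <> 0 by move=> ye; have := sqF 1 x; rewrite -E ye; lia.
have [xlty|yltx|xy] := ltrgtP x y.
- apply: (square_split_3sqD p y x); try lia.
  apply/eqP => yx; have := sqF 28 x; rewrite -E yx => H.
  have p28 : p = 28%N by lia.
  by rewrite p28 in pp.
- apply: square_split_half; apply: square_split_half.
  have x3y : x <> 3 * y.
    move=> xe; have := sqF 12 y; rewrite -E xe => H.
    have p12 : p = 12%N by lia.
    by rewrite p12 in pp.
  apply: (square_split_3sqD _ (x + y) `|x - 3 * y|); try lia;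
    try (by rewrite real_normK ?num_real //; lia).
  (* The excluded ratio 3 would give 4p = 28(x - 3y)^2, hence p = 7. *)
  apply/eqP => e; have := sqF 7 (x - 3 * y).
  have := congr1 (fun z => z ^+ 2) e; rewrite /= exprMn real_normK ?num_real //.
  lia.
- have := sqF 4 x; rewrite -E xy => H.
  have p4 : p = 4%N by lia.
  by rewrite p4 in pp.
Qed.

(** Thue's lemma makes x^2 + 3y^2 one of p, 2p and 3p; 2p is impossible modulo
    4, and 3p reduces to p by dividing x + y*sqrt(-3) by sqrt(-3). *)
Lemma square_split_prime_sqrtN3 (p : nat) (s : 'F_p) :
  prime p -> (3 < p)%N -> p != 7%N -> s ^+ 2 = - 3 -> square_split p.
Proof.
move=> pp p3 p7 s2.
have s2' : s ^+ 2 = (- 3)%:~R by rewrite s2 rmorphN.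
have [x [y [[x0 y0] xy xp yp [k E]]]] := thue_prime p (- 3) s pp s2'.
have [k1|[k2|k3]] : k = 1 \/ k = 2 \/ k = 3 by nia.
- by apply: (square_split_prime_sqD3sq p x y) => //; rewrite k1 in E; lia.
- have [pe|podd] := even_prime pp; first by lia.
  have [u [ux|ux]] := int_even_or_odd (x - y).
    have xe : x = y + 2 * u by lia.
    by rewrite xe k2 in E; lia.
  have xe : x = y + 2 * u + 1 by lia.
  by rewrite xe k2 in E; lia.
- have [u xu] : exists u, x = 3 * u.
    have [u xu] : exists u, x = 3 * u \/ x = 3 * u + 1 \/ x = 3 * u + 2.
      by exists (x %/ 3)%Z; lia.
    by exists u; case: xu => [//|[]] xu; rewrite xu k3 in E; lia.
  by apply: (square_split_prime_sqD3sq p y u) => //; rewrite xu k3 in E; lia.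
Qed.

Lemma square_split_prime (p : nat) :
  prime p -> (3 < p)%N -> p != 7%N -> square_split p.
Proof.
move=> pp p3 p7.
have [pe|podd] := even_prime pp; first by lia.
have [p1|p3'] : (p %% 4 = 1)%N \/ (p %% 4 = 3)%N by lia.
- have [s s2] := Fp_sqrtN1 p pp p1.
  have [x [y [[x0 y0] xy xp yp [k E]]]] := thue_prime p (- 1) s pp s2.
  have k1 : k = 1 by nia.
  by apply: (square_split_prime_sqDsq p x y) => //; rewrite k1 in E; lia.
have n3 : (3 : 'F_p) != 0.
  rewrite -(dvdn_pcharf (pchar_Fp pp)); apply/negP => /dvdn_leq; lia.
have [s [s2|s2]] := Fp_sqrt_pm p 3 pp p3' n3.
- exact: square_split_prime_sqrt3 s2.
- exact: square_split_prime_sqrtN3 s2.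
Qed.

Local Close Scope ring_scope.

(** * Reduction to primes *)

Lemma square_split_dvdn d n : 0 < n -> d %| n -> square_split d -> square_split n.
Proof.
move=> n0 /dvdnP[k nE]; rewrite nE; apply: square_split_muln.
by rewrite nE muln_gt0 in n0; case/andP: n0.
Qed.

Lemma square_split_pow2 a n : square_split (2 ^ a * n) -> square_split n.
Proof.
by elim: a => [|a IHa]; rewrite ?mul1n // expnS -mulnA => /square_split_half.
Qed.

Lemma square_split_pow3 b : ~ square_split (3 ^ b).
Proof.
elim: b => [|[|b] IHb]; [exact: square_split1|exact: square_split3|].
by rewrite !expnS => /square_split_third; rewrite -expnS.
Qed.

Lemma prime_gt3_dvd_or_2_3 n : 0 < n ->
  (exists q, [/\ prime q, 3 < q & q %| n]) \/ exists a b, n = 2 ^ a * 3 ^ b.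
Proof.
elim/ltn_ind: n => n IHn n0; have [n1|n1] := leqP n 1.
  by right; exists 0, 0; lia.
have := (pdiv_prime n1, pdiv_dvd n); move: (pdiv n) => q [pq qn].
have [q3|q3] := ltnP 3 q; first by left; exists q.
have /dvdnP[m nE] := qn.
have m0 : 0 < m by move: n0; rewrite nE muln_gt0 => /andP[].
have mn : m < n by rewrite nE ltn_Pmulr // prime_gt1.
have [[r [pr r3 rm]]|[a [b mE]]] := IHn m mn m0.
  by left; exists r; split; rewrite // nE dvdn_mulr.
have [q2|q3'] : q = 2 \/ q = 3 by have := prime_gt1 pq; lia.
- by right; exists a.+1, b; rewrite nE mE q2 expnS; lia.
- by right; exists a, b.+1; rewrite nE mE q3' expnS; lia.
Qed.

Theorem theorem1p3 (n : nat) (n_gt0 : 0 < n) :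
  (exists x y z : nat,
     [/\ 0 < x, 0 < y, 0 < z, n = x + y + z
       & perfect_square (x ^ 2 + y ^ 2 + z ^ 2)])
  <->
  (~ (exists a b : nat, n = 2 ^ a * 3 ^ b)
   /\ ~ (exists a : nat, n = 2 ^ a * 7)).
Proof.
rewrite -/(square_split n); split.
  move=> sn; split.
    by case=> a [b nE]; move: sn; rewrite nE => /square_split_pow2/square_split_pow3.
  by case=> a nE; move: sn; rewrite nE => /square_split_pow2/square_split7.
case=> n23 n7.
have [[q [pq q3 qn]]|//] := prime_gt3_dvd_or_2_3 n n_gt0.
have [q7|q7] := eqVneq q 7; last first.
  exact: square_split_dvdn qn (square_split_prime q pq q3 q7).
rewrite {}q7 in qn.
have /dvdnP[m nE] := qn.
have m0 : 0 < m by move: n_gt0; rewrite nE muln_gt0 => /andP[].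
have [[r [pr r3 rm]]|[a [[|b] mE]]] := prime_gt3_dvd_or_2_3 m m0.
- have [r7|r7] := eqVneq r 7; last first.
    apply: square_split_dvdn (square_split_prime r pr r3 r7) => //.
    by rewrite nE dvdn_mulr.
  apply: (square_split_dvdn 49) => //.
    by rewrite nE (@dvdn_mul 7 7) // -r7.
  by apply/square_splitE; exists 1, 18, 30, 35.
- by case: n7; exists a; rewrite nE mE muln1.
- apply: (square_split_dvdn 21) => //.
    by rewrite nE mE expnS (@dvdn_mul 3 7) // dvdn_mull // dvdn_mulr.
  by apply/square_splitE; exists 2, 5, 14, 15.
Qed.
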